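(* Let $M$ be a complex manifold, $E\to M$ a holomorphic vector bundle and $F\subset E$ a sub vector bundle of rank $\le 3$ with $E=F\oplus F'$ as vector bundles. For $\alpha\in Z^1(M,G_E)$ set $$\alpha_F:=\Lambda pr_F\circ\alpha|_{\Lambda F}\in C^1(M,End(\Lambda F)).$$ Then the cochain $\alpha_F$ lies in $Z^1(M,G_F)$, and the map $$H^1(M,G_E)\longrightarrow H^1(M,G_F),\qquad[\alpha]\longmapsto[\alpha_F]$$ is well-defined.
   Context: For a holomorphic vector bundle $E\to M$, $\mathcal O_{\Lambda E}$ is the sheaf of holomorphic sections of the full exterior power $\Lambda E$. $G_E$ is the sheaf of groups (under composition) of automorphisms $\varphi$ of the sheaf of $\mathbb Z/2\mathbb Z$-graded $\mathbb C$-algebras $\mathcal O_{\Lambda E}$ (not necessarily $\mathcal O_M$-linear) satisfying $(\varphi-Id)(\mathcal O_{\Lambda^jE})\subset\bigoplus_{k\ge1}\mathcal O_{\Lambda^{j+2k}E}$ for all $j\ge0$; $G_F$ is defined in the same way for $F$. $C^1,Z^1,H^1$ are Čech $1$-cochains, $1$-cocycles ($\alpha_{ij}\alpha_{jk}=\alpha_{ik}$) and first cohomology; $H^1(M,G_E)$ is the pointed set of cocycles modulo $\alpha_{ij}\sim\beta_i\alpha_{ij}\beta_j^{-1}$, $\beta\in C^0(M,G_E)$. The projection $pr_F:E\to F$ along $F'$ is extended to the algebra morphism $\Lambda pr_F:\mathcal O_{\Lambda E}\to\mathcal O_{\Lambda F}$, and $\mathcal O_{\Lambda F}\subset\mathcal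 O_{\Lambda E}$ via $F\subset E$; $\alpha|_{\Lambda F}$ is the restriction to $\mathcal O_{\Lambda F}$. $End(\Lambda F)$ is the sheaf of endomorphisms of the sheaf of complex vector spaces $\mathcal O_{\Lambda F}$. The rank of $E$ is arbitrary ($\ge rk(F)$). *)

(* Defs.v *)
From HB Require Import structures.
From mathcomp Require Import all_boot all_order all_algebra.
From mathcomp Require Import complex ring.
Set Implicit Arguments. Unset Strict Implicit. Unset Printing Implicit Defensive.
Import Order.TTheory GRing.Theory Num.Theory.
Local Open Scope ring_scope.

(* The exterior algebra of K^n with basis e_S = e_{i_1} ... e_{i_p} for
   S = {i_1 < ... < i_p}; a is identified with its coordinates a S. *)
Definition extalg (K : fieldType) (n : nat) : Type := {ffun {set 'I_n} -> K}.
HB.instance Definition _ K n := GRing.Lmodule.copy (extalg K n) {ffun {set 'I_n} -> K^o}.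

Section ExtAlgebra.
Variables (K : fieldType) (n : nat).
Implicit Types (a b c : extalg K n) (S T U : {set 'I_n}).

(* Number of inversions (i in S, j in T, j < i): for disjoint S and T,
   e_S e_T = (-1)^(invs S T) e_{S U T}. *)
Definition invs S T : nat := \sum_(i in S) \sum_(j in T) (j < i)%N.

Definition ext_one : extalg K n := [ffun S => (S == set0)%:R].
Definition ext_mul a b : extalg K n :=
  [ffun U : {set 'I_n} => \sum_(S : {set 'I_n} | S \subset U) (-1) ^+ invs S (U :\: S) * (a S * b (U :\: S))].

Lemma invsUl S T U : [disjoint S & T] -> invs (S :|: T) U = (invs S U + invs T U)%N.
Proof. by move=> d; rewrite /invs -bigU //; apply: eq_bigl => i; rewrite !inE. Qed.
Lemma invsUr S T U : [disjoint S & T] -> invs U (S :|: T) = (invs U S + invs U T)%N.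
Proof.
move=> d; rewrite /invs -big_split /=; apply: eq_bigr => i _.
by rewrite -bigU //; apply: eq_bigl => j; rewrite !inE.
Qed.
Lemma invs0l T : invs set0 T = 0%N. Proof. by rewrite /invs big_set0. Qed.
Lemma invs0r T : invs T set0 = 0%N.
Proof. by rewrite /invs big1 // => i _; rewrite big_set0. Qed.

Lemma ext_mulA : associative ext_mul.
Proof.
move=> a b c; apply/ffunP => U; rewrite !ffunE.
under eq_bigr => P sPU do rewrite ffunE mulr_sumr mulr_sumr.
under [RHS]eq_bigr => S sSU do rewrite ffunE mulr_suml mulr_sumr.
rewrite [RHS](exchange_big_dep (fun P : {set _} => P \subset U)) /=; last first.
  by move=> S P sSU sPS; apply: subset_trans sSU.
apply: eq_bigr => P sPU.
rewrite [RHS](reindex_onto (fun Q => P :|: Q) (fun S => S :\: P)) /=; last first.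
  by move=> S /andP[_ /setUidPr <-]; apply/setP => i; rewrite !inE; case: (i \in P).
apply: eq_big => [Q|Q].
  apply/idP/idP.
    move=> sQ; rewrite subUset sPU (subset_trans sQ (subsetDl _ _)) subsetUl /=.
    apply/eqP/setP => i; rewrite !inE; have := subsetP sQ i; rewrite !inE.
    by case: (i \in P); case: (i \in Q) => // /(_ isT).
  case/andP=> /andP[]; rewrite subUset => /andP[_ sQU] _ /eqP QE.
  by rewrite subsetD sQU -QE disjoints_subset; apply/subsetP => i; rewrite !inE => /andP[].
rewrite subsetD => /andP[sQU dQP].
have E1 : (U :\: P) :\: Q = U :\: (P :|: Q) by rewrite setDDl.
have E2 : (P :|: Q) :\: P = Q.
  apply/setP => i; rewrite !inE; have := disjointFr dQP (x := i).
  by case: (i \in P); case: (i \in Q) => //= /(_ isT).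
have dPQ : [disjoint P & Q] by rewrite disjoint_sym.
have E3 : U :\: P = Q :|: (U :\: (P :|: Q)).
  apply/setP => i; rewrite !inE; move: (disjointFr dQP (x := i)) (subsetP sQU i).
  by case: (i \in P); case: (i \in Q); case: (i \in U) => //= h1 h2;
     solve [by have := h1 isT | by have := h2 isT].
rewrite E1 E2 {1}E3 invsUr; last first.
  by rewrite -setI_eq0; apply/eqP/setP => i; rewrite !inE; case: (i \in Q); rewrite ?andbF ?orbT.
rewrite invsUl // !exprD.
set u := _ ^+ invs P Q; set v := _ ^+ invs P _; set w := _ ^+ invs Q _; clearbody u v w; ring.
Qed.

Lemma ext_mul1l : left_id ext_one ext_mul.
Proof.
move=> a; apply/ffunP => U; rewrite ffunE (bigD1 set0) ?sub0set //= big1 ?addr0.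
  by rewrite ffunE eqxx setD0 invs0l expr0 !mul1r.
by move=> S /andP[_ /negPf nS]; rewrite ffunE nS mul0r mulr0.
Qed.

Lemma ext_mul1r : right_id ext_one ext_mul.
Proof.
move=> a; apply/ffunP => U; rewrite ffunE (bigD1 U) //= big1 ?addr0.
  by rewrite ffunE setDv eqxx invs0r expr0 mul1r mulr1.
move=> S /andP[sSU nS]; rewrite ffunE setD_eq0.
suff /negPf-> : ~~ (U \subset S) by rewrite !mulr0.
by apply: contra nS => sUS; rewrite eqEsubset sSU.
Qed.

Lemma ext_mulDl : left_distributive ext_mul +%R.
Proof.
move=> a b c; apply/ffunP => U; rewrite !ffunE -big_split; apply: eq_bigr => S _.
by rewrite ffunE mulrDl mulrDr.
Qed.

Lemma ext_mulDr : right_distributive ext_mul +%R.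
Proof.
move=> a b c; apply/ffunP => U; rewrite !ffunE -big_split; apply: eq_bigr => S _.
by rewrite ffunE !mulrDr.
Qed.

Lemma ext_one_neq0 : ext_one != 0.
Proof.
by apply/eqP => /ffunP/(_ set0); rewrite !ffunE eqxx => /eqP; rewrite oner_eq0.
Qed.

HB.instance Definition _ := GRing.Zmodule_isNzRing.Build (extalg K n)
  ext_mulA ext_mul1l ext_mul1r ext_mulDl ext_mulDr ext_one_neq0.

Lemma ext_scalerAl (k : K) (a b : extalg K n) : k *: (a * b) = k *: a * b.
Proof.
apply/ffunP => U; rewrite !ffunE scaler_sumr; apply: eq_bigr => S _.
by rewrite ffunE /GRing.scale /=; ring.
Qed.
HB.instance Definition _ := GRing.Lmodule_isLalgebra.Build K (extalg K n) ext_scalerAl.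
Lemma ext_scalerAr (k : K) (a b : extalg K n) : k *: (a * b) = a * (k *: b).
Proof.
apply/ffunP => U; rewrite !ffunE scaler_sumr; apply: eq_bigr => S _.
by rewrite ffunE /GRing.scale /=; ring.
Qed.
HB.instance Definition _ := GRing.Lalgebra_isAlgebra.Build K (extalg K n) ext_scalerAr.
End ExtAlgebra.

Section Wedge.
Variables (A : pzRingType) (n : nat) (x : 'I_n -> A).
Definition wedge (S : {set 'I_n}) : A := \prod_(i in S) x i.
Hypothesis xx : forall i, x i * x i = 0.
Hypothesis xC : forall i j, x i * x j = - (x j * x i).

Let ltI : rel 'I_n := fun i j => (i < j)%N.
Let below (i : 'I_n) (T : {set 'I_n}) := (\sum_(j in T) (j < i))%N.

Lemma sgnCA (a b : A) m : a * ((-1) ^+ m * b) = (-1) ^+ m * (a * b).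
Proof. by rewrite !mulrA commr_sign. Qed.

Lemma wedge_insert (r : seq 'I_n) i (T : {set 'I_n}) : sorted ltI r -> i \in r ->
  x i * \prod_(j <- r | j \in T) x j =
  if i \in T then 0 else
  (-1) ^+ (\sum_(j <- r | j \in T) (j < i))%N * \prod_(j <- r | j \in i |: T) x j.
Proof.
elim: r => // h t IH /= hsort; have htr : transitive ltI by move=> a b c; apply: ltn_trans.
move: (hsort); rewrite (path_sortedE htr) => /andP[/allP hmin tsort].
rewrite !big_cons inE eq_sym; have [<- _|nhi /= it] := eqVneq h i.
  have hnt : h \notin t by apply/negP => /hmin; rewrite /ltI ltnn.
  case: ifP => hT; first by rewrite mulrA xx mul0r.
  have -> : (\sum_(j <- t | j \in T) (j < h) = 0)%N.
    rewrite big_seq_cond big1 // => j /andP[/hmin]; rewrite /ltI => hj _.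
    by rewrite ltnNge ltnW.
  rewrite !inE eqxx /= ?hT ?ltnn ?add0n mul1r.
  congr (_ * _); rewrite big_seq_cond [RHS]big_seq_cond; apply: eq_bigl => j.
  rewrite !inE; case jt: (j \in t) => //=.
  by case: eqVneq => // jh; move: hnt; rewrite -jh jt.
have hi : (h < i)%N by apply: hmin.
have IHi := IH tsort it.
rewrite !inE (negPf nhi) /= hi.
case: ifP => [hT|hT] //.
rewrite mulrA xC mulNr -mulrA IHi; case: ifP => iT; first by rewrite mulr0 oppr0.
by rewrite sgnCA add1n exprS mulN1r mulNr.
Qed.

Lemma enum_ltI : sorted ltI (index_enum 'I_n).
Proof.
have := iota_ltn_sorted 0 n; rewrite -val_enum_ord sorted_map.
by rewrite enumT.
Qed.

Lemma wedge1 i T : x i * wedge T =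
  if i \in T then 0 else (-1) ^+ below i T * wedge (i |: T).
Proof. exact: wedge_insert enum_ltI (mem_index_enum i). Qed.

Lemma wedge_mul S T : wedge S * wedge T =
  if [disjoint S & T] then (-1) ^+ invs S T * wedge (S :|: T) else 0.
Proof.
suff H r : sorted ltI r -> (\prod_(j <- r | j \in S) x j) * wedge T =
  if [disjoint (S :&: [set j in r]) & T]
  then (-1) ^+ (\sum_(j <- r | j \in S) below j T)%N * wedge ((S :&: [set j in r]) :|: T) else 0.
  rewrite [wedge S]/wedge H ?enum_ltI //.
  suff -> : S :&: [set j in index_enum 'I_n] = S by [].
  by apply/setP => i; rewrite !inE mem_index_enum andbT.
elim: r => [_|h t IH /= hsort].
  have -> : S :&: [set j in [::]] = set0 by apply/setP => i; rewrite !inE andbF.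
  by rewrite !big_nil disjoints_subset sub0set set0U !mul1r.
have htr : transitive ltI by move=> a b c; apply: ltn_trans.
move: (hsort); rewrite (path_sortedE htr) => /andP[/allP hmin /IH {}IH].
have hnt : h \notin t by apply/negP => /hmin; rewrite /ltI ltnn.
rewrite !big_cons set_cons; case: ifPn => hS; last first.
  suff -> : S :&: (h |: [set j in t]) = S :&: [set j in t] by [].
  apply/setP => i; rewrite !inE; case: eqVneq => //= ->.
  by rewrite (negPf hS).
have -> : S :&: (h |: [set j in t]) = h |: (S :&: [set j in t]).
  by apply/setP => i; rewrite !inE; case: eqVneq => //= ->; rewrite hS.
have dU B : [disjoint h |: B & T] = (h \notin T) && [disjoint B & T].
  by rewrite !disjoints_subset subUset sub1set inE.
rewrite -mulrA IH dU; set S' := S :&: _.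
case: ifP => dS'; last by rewrite andbF mulr0.
rewrite sgnCA wedge1 andbT !inE (negPf hnt) andbF /=.
case: ifP => hT /=; first by rewrite mulr0.
rewrite mulrA -exprD setUA; congr (_ ^+ _ * _).
rewrite addnC; congr (_ + _)%N.
have -> : below h (S' :|: T) = (below h S' + below h T)%N.
  by rewrite /below -bigU //; apply: eq_bigl => j; rewrite !inE.
rewrite [below h S']/below big1 ?add0n // => j.
by rewrite !inE => /andP[_ /hmin hj]; rewrite ltnNge ltnW.
Qed.
End Wedge.

Section Basis.
Variables (K : fieldType) (n : nat).
Definition ext_delta (S : {set 'I_n}) : extalg K n := [ffun T => (T == S)%:R].

Lemma ext_sum_delta (a : extalg K n) : a = \sum_S a S *: ext_delta S.
Proof.
apply/ffunP => T; rewrite sum_ffunE (bigD1 T) //= big1 => [|S nST].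
  by rewrite !ffunE eqxx addr0 /GRing.scale /= mulr1.
by rewrite !ffunE eq_sym (negPf nST) scaler0.
Qed.

Lemma ext_deltaM S T : ext_delta S * ext_delta T =
  if [disjoint S & T] then (-1) ^+ invs S T *: ext_delta (S :|: T) else 0.
Proof.
apply/ffunP => U; rewrite ffunE.
case: ifPn => dST; last first.
  rewrite ffunE big1 // => P _; rewrite !ffunE.
  have [->|] := eqVneq P S; last by rewrite mul0r mulr0.
  have [UST|] := eqVneq (U :\: S) T; last by rewrite !mulr0.
  case/negP: dST; rewrite -UST disjoints_subset; apply/subsetP => i.
  by rewrite !inE => ->.
have dST' : (S :|: T) :\: S = T.
  apply/setP => i; rewrite !inE; have := disjointFr dST (x := i).
  by case: (i \in S); case: (i \in T) => //= /(_ isT).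
rewrite !ffunE; have [->|nU] := eqVneq U (S :|: T).
  rewrite (bigD1 S) ?subsetUl //= big1 ?addr0 => [|P /andP[_ nP]]; last first.
    by rewrite !ffunE (negPf nP) mul0r mulr0.
  by rewrite !ffunE dST' !eqxx mulr1.
rewrite scaler0 big1 // => P sPU; rewrite !ffunE.
have [EP|] := eqVneq P S; last by rewrite mul0r mulr0.
have [ET|] := eqVneq (U :\: P) T; last by rewrite !mulr0.
case/negP: nU; apply/eqP/setP => i; rewrite -ET -EP !inE.
by move: (subsetP sPU i); case: (i \in P); case: (i \in U) => //= /(_ isT).
Qed.

Definition ext_gen (i : 'I_n) : extalg K n := ext_delta [set i].

Lemma ext_genM i : ext_gen i * ext_gen i = 0.
Proof. by rewrite ext_deltaM disjoints1 !inE eqxx. Qed.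
Lemma ext_genC i j : ext_gen i * ext_gen j = - (ext_gen j * ext_gen i).
Proof.
have [->|nij] := eqVneq i j; first by rewrite ext_genM oppr0.
rewrite !ext_deltaM !disjoints1 !inE (negPf nij) eq_sym (negPf nij) setUC -scaleNr.
congr (_ *: _); rewrite /invs !big_set1.
by have [] := ltngtP i j; rewrite ?expr1 ?expr0 ?opprK //= => /val_inj E; rewrite E eqxx in nij.
Qed.
End Basis.

(* The exterior algebra of a finite-dimensional space V, in coordinates with
   respect to the basis vbasis {:V}; ext_iota is the inclusion of V and ext_map
   the algebra morphism extending a linear map (see ext_mapM, ext_map1 and
   ext_map_iota), so the choice of basis is immaterial. *)
Notation Lambda V := (extalg _ (\dim {:V})).

Section Map.
Variable K : fieldType.
Definition ext_iota (V : vectType K) (v : V) : Lambda V :=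
  \sum_i coord (vbasis {:V}) i v *: ext_gen K i.

Lemma ext_iota_is_linear (V : vectType K) : linear (@ext_iota V).
Proof.
move=> k u v; rewrite /ext_iota scaler_sumr -big_split; apply: eq_bigr => i _.
by rewrite linearP scalerDl scalerA.
Qed.
HB.instance Definition _ (V : vectType K) := GRing.isLinear.Build K V (Lambda V) *:%R (@ext_iota V) (@ext_iota_is_linear V).

Lemma ext_iotaC (V : vectType K) (u v : V) : ext_iota u * ext_iota v = - (ext_iota v * ext_iota u).
Proof.
rewrite /ext_iota !mulr_suml -sumrN.
under eq_bigr do rewrite mulr_sumr; rewrite exchange_big; apply: eq_bigr => i _ /=.
rewrite mulr_sumr -sumrN; apply: eq_bigr => j _.
by rewrite -!scalerAl -!scalerAr ext_genC !scalerN !scalerA mulrC.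
Qed.

Definition ext_map (V W : vectType K) (f : V -> W) (a : Lambda V) : Lambda W :=
  \sum_S a S *: wedge (fun i => ext_iota (f (vbasis {:V})`_i)) S.

Lemma ext_map_is_linear (V W : vectType K) (f : V -> W) : linear (ext_map f).
Proof.
move=> k a b; rewrite /ext_map scaler_sumr -big_split; apply: eq_bigr => S _.
by rewrite !ffunE scalerDl scalerA.
Qed.
HB.instance Definition _ (V W : vectType K) (f : V -> W) := GRing.isLinear.Build K (Lambda V) (Lambda W) *:%R
  (@ext_map V W f) (@ext_map_is_linear V W f).

End Map.

Section MapNum.
Variable K : numFieldType.
Lemma ext_iotaM (V : vectType K) (v : V) : ext_iota v * ext_iota v = 0.
Proof.
have /eqP := ext_iotaC v v.
rewrite -addr_eq0 -mulr2n -scaler_nat scaler_eq0 pnatr_eq0 /=.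
by move/eqP.
Qed.

Lemma ext_map_delta (V W : vectType K) (f : V -> W) S :
  ext_map f (ext_delta K S) = wedge (fun i => ext_iota (f (vbasis {:V})`_i)) S.
Proof.
rewrite /ext_map (bigD1 S) //= [X in _ + X]big1 ?addr0 => [|T nT].
  by rewrite ffunE eqxx scale1r.
by rewrite ffunE (negPf nT) scale0r.
Qed.

Lemma ext_mapM (V W : vectType K) (f : V -> W) : {morph ext_map f : a b / a * b}.
Proof.
move=> a b; rewrite [a]ext_sum_delta [b]ext_sum_delta.
rewrite mulr_suml !linear_sum mulr_suml; apply: eq_bigr => S _ /=.
rewrite -scalerAl !linearZ -scalerAl; congr (_ *: _).
rewrite [in LHS]mulr_sumr [in RHS]mulr_sumr linear_sum; apply: eq_bigr => T _ /=.
rewrite -!scalerAr !linearZ -scalerAr; congr (_ *: _).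
rewrite ext_deltaM /= !ext_map_delta.
rewrite (@wedge_mul (Lambda W) (\dim {:V}) (fun i => ext_iota (f (vbasis {:V})`_i)) (fun i => ext_iotaM _) (fun i j => ext_iotaC _ _)).
case: ifP => _; last by rewrite linear0.
by rewrite linearZ /= ext_map_delta -signr_odd -[in RHS]signr_odd; case: odd; rewrite ?expr1 ?expr0 ?scaleN1r ?mulN1r ?scale1r ?mul1r.
Qed.

Lemma ext_delta0 n : ext_delta K (set0 : {set (ordinal n)}) = 1.
Proof. by []. Qed.

Lemma ext_map1 (V W : vectType K) (f : V -> W) : ext_map f 1 = 1.
Proof. by rewrite -ext_delta0 ext_map_delta /wedge big_set0. Qed.

Lemma ext_map_prod (V W : vectType K) (f : V -> W) I (r : seq I) (P : pred I) (F : I -> Lambda V) :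
  ext_map f (\prod_(i <- r | P i) F i) = \prod_(i <- r | P i) ext_map f (F i).
Proof. exact: (big_morph _ (ext_mapM f) (ext_map1 f)). Qed.

Lemma ext_map_iota (V W : vectType K) (f : {linear V -> W}) v :
  ext_map f (ext_iota v) = ext_iota (f v).
Proof.
rewrite [v in RHS](coord_vbasis (memvf v)) !linear_sum; apply: eq_bigr => i _ /=.
by rewrite !linearZ /= ext_map_delta /wedge big_set1.
Qed.
End MapNum.

(* All homogeneous components of a have degree in P. *)
Definition ext_supp (K : fieldType) n (P : nat -> Prop) (a : extalg K n) :=
  forall S, a S != 0 -> P #|S|.

(* Imported only here: classical_sets shadows the finset notations used above. *)
From mathcomp Require Import boolp classical_sets functions reals topology.
From mathcomp Require Import normedtype landau derive interval_inference.
Import numFieldNormedType.Exports.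
Local Open Scope classical_set_scope.

Lemma near_eq_differentiable (K : numFieldType) (V W : normedModType K)
  (f g : V -> W) (x : V) :
  {near x, f =1 g} -> differentiable f x -> differentiable g x.
Proof.
move=> fg df; have fgx : f x = g x := nbhs_singleton fg.
have H : g \o shift x = cst (g x) + 'd f x +o_ 0 id.
  apply/eqaddoP => _/posnumP[eps].
  have /eqaddoP/(_ eps%:num (gt0 eps)) := diff_locally df.
  have fg0 : \forall h \near 0, f (h + x) = g (h + x).
    by have := fg; rewrite (near_shift 0 x) /= subr0.
  apply: filterS2 fg0 => h E; rewrite /= -fgx.
  by rewrite -[X in _ -> `|X| <= _]/(g (h + x) - (f x + 'd f x h)) -E.
have E := diff_unique (diff_continuous df) H.
by apply/diff_locallyP; rewrite E; split => //; apply: diff_continuous.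
Qed.

Definition Cplx (R : realType) : numFieldType := R[i].

(* The points cmap a x are the coordinates of x in the chart a, and cinv a is
   only meaningful on the open set cmap a @` cdom a. Differentiability is over
   the complex field, i.e. the coordinate changes are holomorphic. *)
Record cmanifold (R : realType) (n : nat) := CManifold {
  cm_top :> topologicalType;
  cm_hausdorff : hausdorff_space cm_top;
  cm_countable : @second_countable cm_top;
  chart : Type;
  cdom : chart -> set cm_top;
  cmap : chart -> cm_top -> 'rV[Cplx R]_n;
  cinv : chart -> 'rV[Cplx R]_n -> cm_top;
  cdom_open : forall a, open (cdom a);
  cdom_cover : forall x, exists a, cdom a x;
  cimg_open : forall a, open (cmap a @` cdom a);
  cmapK : forall a x, cdom a x -> cinv a (cmap a x) = x;
  cmap_cts : forall a x, cdom a x -> {for x, continuous (cmap a)};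
  cinv_cts : forall a x, cdom a x -> {for cmap a x, continuous (cinv a)};
  ctrans_holo : forall a b x, cdom a x -> cdom b x ->
    differentiable (cmap b \o cinv a) (cmap a x) }.

Section Holo.
Variables (R : realType) (n : nat) (M : cmanifold R n).
Local Notation C := (Cplx R).
Implicit Types (g h : M -> C) (x : M).

(* Complex differentiability at the point x; holomorphic on an open set means
   complex differentiable at all of its points. *)
Definition holo_at g x :=
  forall a : chart M, cdom a x -> differentiable (g \o cinv a) (cmap a x).
Definition holo_on (U : set M) g := forall x, U x -> holo_at g x.

Lemma holo_at_cst (k : C) x : holo_at (fun=> k) x.
Proof. by move=> a _; exact: differentiable_cst. Qed.
Lemma holo_atD g h x : holo_at g x -> holo_at h x -> holo_at (fun y => g y + h y) x.
Proof. by move=> hg hh a ax; exact: (differentiableD (hg a ax) (hh a ax)). Qed.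
Lemma holo_atM g h x : holo_at g x -> holo_at h x -> holo_at (fun y => g y * h y) x.
Proof. by move=> hg hh a ax; exact: (differentiableM (hg a ax) (hh a ax)). Qed.
Lemma holo_atV g x : g x != 0 -> holo_at g x -> holo_at (fun y => (g y)^-1) x.
Proof.
move=> gx hg a ax; apply: (differentiableV (hg a ax)).
by rewrite /= cmapK.
Qed.
Lemma holo_at_sum I (r : seq I) (P : pred I) (g : I -> M -> C) x :
  (forall i, holo_at (g i) x) -> holo_at (fun y => \sum_(i <- r | P i) g i y) x.
Proof.
move=> hg; elim: r => [|i r IH].
  rewrite (_ : (fun y => _) = fun=> 0); first exact: holo_at_cst.
  by apply/funext => y; rewrite big_nil.
rewrite (_ : (fun y => _) = fun y => (if P i then g i y else 0) + \sum_(i <- r | P i) g i y).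
  apply: holo_atD => //; case: (P i) => //; exact: holo_at_cst.
by apply/funext => y; rewrite big_cons; case: ifP => // _; rewrite add0r.
Qed.
Lemma holo_at_prod I (r : seq I) (P : pred I) (g : I -> M -> C) x :
  (forall i, holo_at (g i) x) -> holo_at (fun y => \prod_(i <- r | P i) g i y) x.
Proof.
move=> hg; elim: r => [|i r IH].
  rewrite (_ : (fun y => _) = fun=> 1); first exact: holo_at_cst.
  by apply/funext => y; rewrite big_nil.
rewrite (_ : (fun y => _) = fun y => (if P i then g i y else 1) * \prod_(i <- r | P i) g i y).
  apply: holo_atM => //; case: (P i) => //; exact: holo_at_cst.
by apply/funext => y; rewrite big_cons; case: ifP => // _; rewrite mul1r.
Qed.
Lemma holo_at_det m (A : M -> 'M[C]_m) x :
  (forall i j, holo_at (fun y => A y i j) x) -> holo_at (fun y => \det (A y)) x.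
Proof.
move=> hA; rewrite /determinant; apply: holo_at_sum => s.
by apply: holo_atM; [exact: holo_at_cst | apply: holo_at_prod].
Qed.
Lemma holo_at_invmx m (A : M -> 'M[C]_m) x i j : A x \in unitmx ->
  (forall i j, holo_at (fun y => A y i j) x) ->
  holo_at (fun y => (\det (A y))^-1 * (\adj (A y)) i j) x.
Proof.
move=> uA hA; apply: holo_atM.
  by apply: holo_atV; [rewrite -unitfE -unitmxE | exact: holo_at_det].
rewrite (_ : (fun y => _) = fun y => (-1) ^+ (j + i) * \det (row' j (col' i (A y)))).
  apply: holo_atM; first exact: holo_at_cst.
  apply: holo_at_det => p q.
  rewrite (_ : (fun y => _) = fun y => A y (lift j p) (lift i q)); first exact: hA.
  by apply/funext => y; rewrite !mxE.
by apply/funext => y; rewrite mxE.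
Qed.

(* A holomorphic vector bundle structure of rank r on a family of vector
   spaces: local frames over an open cover (equivalently, fibrewise linear local
   trivializations) with holomorphic transition matrices. *)
Record frames (V : M -> vectType C) (r : nat) := Frames {
  fidx : Type;
  fdom : fidx -> set M;
  frame : fidx -> forall x, r.-tuple (V x);
  fdom_open : forall b, open (fdom b);
  fdom_cover : forall x, exists b, fdom b x;
  frame_basis : forall b x, fdom b x -> basis_of {:V x} (frame b x);
  ftrans_holo : forall b c i j, holo_on (fdom b `&` fdom c)
    (fun x => coord (frame b x) i (tnth (frame c x) j)) }.

Record hvb (r : nat) := HVB {
  fibre :> M -> vectType C;
  fatlas : frames fibre r }.

Record opens := Opens { oset :> set M; _ : open oset }.
Lemma opens_open (U : opens) : open U. Proof. by case: U. Qed.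
Definition ocap (U V : opens) : opens :=
  Opens (openI (opens_open U) (opens_open V)).

End Holo.

Section Local.
Variables (R : realType) (n : nat) (M : cmanifold R n).
Local Notation C := (Cplx R).

Definition iota_frame (V : M -> vectType C) r (e : forall x, r.-tuple (V x)) y (i : 'I_r) :=
  ext_iota (tnth (e y) i).

(* Near x, s is a combination of the wedge products e_S of the frame e with
   holomorphic coefficients. *)
Definition locO (V : M -> vectType C) r (e : forall x, r.-tuple (V x)) (x : M) (s : forall y, Lambda (V y)) :=
  exists c : {set 'I_r} -> M -> C,
   (\forall y \near x, forall S, holo_at (c S) y) /\
   (\forall y \near x, s y = \sum_S c S y *: wedge (iota_frame e y) S).

Variables (V : M -> vectType C) (r : nat) (e : forall x, r.-tuple (V x)) (x : M).

Lemma locO_congr s t : locO e x s -> (\forall y \near x, s y = t y) -> locO e x t.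
Proof.
move=> [c [hc hs]] st; exists c; split=> //.
by apply: filterS2 hs st => y -> ->.
Qed.

Lemma locO0 : locO e x (fun=> 0).
Proof.
exists (fun _ _ => 0); split; apply: nearW => y; first by move=> S; apply: holo_at_cst.
by rewrite big1 // => S _; rewrite scale0r.
Qed.

Lemma locOD s t : locO e x s -> locO e x t -> locO e x (fun y => s y + t y).
Proof.
move=> [c [hc hs]] [d [hd ht]]; exists (fun S y => c S y + d S y); split.
  by apply: filterS2 hc hd => y h1 h2 S; apply: holo_atD.
apply: filterS2 hs ht => y -> ->; rewrite -big_split; apply: eq_bigr => S _ /=.
by rewrite scalerDl.
Qed.

Lemma locOZ (k : M -> C) s : (\forall y \near x, holo_at k y) -> locO e x s -> locO e x (fun y => k y *: s y).
Proof.
move=> hk [c [hc hs]]; exists (fun S y => k y * c S y); split.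
  by apply: filterS2 hc hk => y h1 h2 S; apply: holo_atM.
apply: filterS hs => y ->; rewrite scaler_sumr; apply: eq_bigr => S _ /=.
by rewrite scalerA.
Qed.

Lemma locOZc (k : C) s : locO e x s -> locO e x (fun y => k *: s y).
Proof. by apply: locOZ; apply: nearW => y; apply: holo_at_cst. Qed.

Lemma locO_sum I (l : seq I) (P : pred I) (s : I -> forall y, Lambda (V y)) :
  (forall i, locO e x (s i)) -> locO e x (fun y => \sum_(i <- l | P i) s i y).
Proof.
move=> hs; elim: l => [|i l IH].
  by apply: locO_congr locO0 _; apply: nearW => y; rewrite big_nil.
have := if P i as b return locO e x (fun y => if b then s i y else 0) then hs i else locO0.
move=> h; apply: (locO_congr (locOD h IH)); apply: nearW => y; rewrite big_cons.
by case: (P i); rewrite ?add0r.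
Qed.

Lemma locO_wedge S : locO e x (fun y => wedge (iota_frame e y) S).
Proof.
exists (fun T y => (T == S)%:R); split; apply: nearW => y.
  by move=> T; apply: holo_at_cst.
rewrite (bigD1 S) //= eqxx scale1r [X in _ + X]big1 ?addr0 // => T /negPf->.
by rewrite scale0r.
Qed.

Lemma locO1 : locO e x (fun=> 1).
Proof.
by apply: locO_congr (locO_wedge finset.set0) _; apply: nearW => y; rewrite /wedge big_set0.
Qed.

Lemma locO_iota i : locO e x (fun y => ext_iota (tnth (e y) i)).
Proof.
by apply: locO_congr (locO_wedge (finset.set1 i)) _; apply: nearW => y; rewrite /wedge big_set1.
Qed.

Lemma locOM s t : locO e x s -> locO e x t -> locO e x (fun y => s y * t y).
Proof.
move=> [c [hc hs]] [d [hd ht]].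
have H : locO e x (fun y => \sum_S \sum_T (c S y * d T y) *:
   (wedge (iota_frame e y) S * wedge (iota_frame e y) T)).
  apply: locO_sum => S; apply: locO_sum => T; apply: locOZ.
    by apply: filterS2 hc hd => y h1 h2; apply: holo_atM.
  have W y := @wedge_mul _ _ (iota_frame e y) (fun i => ext_iotaM _)
    (fun i j => ext_iotaC _ _) S T.
  case dST : [disjoint S & T]%B.
    apply: locO_congr (locOZc ((-1) ^+ invs S T) (locO_wedge (finset.setU S T))) _.
    apply: nearW => y; rewrite W dST -signr_odd -[in RHS]signr_odd; case: odd;
      by rewrite ?expr1 ?expr0 ?scaleN1r ?mulN1r ?scale1r ?mul1r.
  by apply: locO_congr locO0 _; apply: nearW => y; rewrite W dST.
apply: locO_congr H _; apply: filterS2 hs ht => y -> ->.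
rewrite mulr_suml; apply: eq_bigr => S _; rewrite mulr_sumr; apply: eq_bigr => T _.
by rewrite -scalerAl -scalerAr scalerA.
Qed.

Lemma locO_prod I (l : seq I) (P : pred I) (s : I -> forall y, Lambda (V y)) :
  (forall i, locO e x (s i)) -> locO e x (fun y => \prod_(i <- l | P i) s i y).
Proof.
move=> hs; elim: l => [|i l IH].
  by apply: locO_congr locO1 _; apply: nearW => y; rewrite big_nil.
have := if P i as b return locO e x (fun y => if b then s i y else 1) then hs i else locO1.
move=> h; apply: (locO_congr (locOM h IH)); apply: nearW => y; rewrite big_cons.
by case: (P i); rewrite ?mul1r.
Qed.
End Local.

Lemma locO_map (R : realType) (n : nat) (M : cmanifold R n)
  (V W : M -> vectType (Cplx R)) r q (e : forall x, r.-tuple (V x))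
  (d : forall x, q.-tuple (W x)) (f : forall x, {linear V x -> W x}) x
  (g : 'I_r -> 'I_q -> M -> Cplx R) :
  (forall i j, \forall y \near x, holo_at (g i j) y) ->
  (\forall y \near x, forall i, f y (tnth (e y) i) = \sum_j g i j y *: tnth (d y) j) ->
  forall s, locO e x s -> locO d x (fun y => ext_map (f y) (s y)).
Proof.
move=> hg hf s [c [hc hs]].
have H : locO d x (fun y => \sum_S c S y *: \prod_(i in S) \sum_j g i j y *: ext_iota (tnth (d y) j)).
  apply: locO_sum => S; apply: locOZ; first by apply: filterS hc => y.
  apply: locO_prod => i; apply: locO_sum => j; apply: locOZ => //; exact: locO_iota.
apply: locO_congr H _; apply: filterS2 hs hf => y -> fE.
rewrite linear_sum; apply: eq_bigr => S _; rewrite linearZ /=; congr (_ *: _).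
rewrite ext_map_prod; apply: eq_bigr => i _.
rewrite ext_map_iota fE linear_sum; apply: eq_bigr => j _.
by rewrite linearZ.
Qed.

Section Sections.
Variables (R : realType) (n : nat) (M : cmanifold R n).
Local Notation C := (Cplx R).

Section OneBundle.
Variables (r : nat) (E : hvb M r).

Definition holo_section (U : set M) (s : forall x, Lambda (E x)) :=
  forall x, U x -> forall b : fidx (fatlas E), fdom b x -> locO (frame b) x s.

(* Sections over U of the sheaf of holomorphic sections of the exterior power
   of E, encoded as total families that vanish outside U. *)
Record OLambda (U : opens M) := OSection {
  hval :> forall x, Lambda (E x);
  hval_holo : holo_section U hval;
  hval_out : forall x, ~ oset U x -> hval x = 0 }.

Lemma hsecP U (s t : OLambda U) : (forall x, s x = t x) -> s = t.
Proof.
case: s t => [s hs os] [t ht ot] /= st.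
have {}st : s = t by apply: functional_extensionality_dep.
by subst t; congr OSection; apply: Prop_irrelevance.
Qed.

Section Ring.
Variable U : opens M.
HB.instance Definition _ := gen_eqMixin (OLambda U).
HB.instance Definition _ := gen_choiceMixin (OLambda U).
Implicit Types s t : OLambda U.

Program Definition hsec0 : OLambda U := @OSection U (fun=> 0) _ _.
Next Obligation. by move=> x _ b _; apply: locO0. Qed.
Next Obligation. by []. Qed.
Program Definition hsecZ (k : C) s : OLambda U := @OSection U (fun x => k *: s x) _ _.
Next Obligation. by move=> k s x Ux b bx; apply: locOZc; apply: (hval_holo s). Qed.
Next Obligation. by move=> k s x Ux /=; rewrite hval_out // scaler0. Qed.
Program Definition hsecN s : OLambda U := @OSection U (fun x => - s x) _ _.
Next Obligation.
move=> s x Ux b bx; have := locOZc (-1) (hval_holo s Ux bx).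
by move/locO_congr; apply; apply: nearW => y; rewrite scaleN1r.
Qed.
Next Obligation. by move=> s x Ux /=; rewrite hval_out // oppr0. Qed.
Program Definition hsecD s t : OLambda U := @OSection U (fun x => s x + t x) _ _.
Next Obligation. by move=> s t x Ux b bx; apply: locOD; [apply: (hval_holo s)|apply: (hval_holo t)]. Qed.
Next Obligation. by move=> s t x Ux /=; rewrite !hval_out // addr0. Qed.
Program Definition hsecM s t : OLambda U := @OSection U (fun x => s x * t x) _ _.
Next Obligation. by move=> s t x Ux b bx; apply: locOM; [apply: (hval_holo s)|apply: (hval_holo t)]. Qed.
Next Obligation. by move=> s t x Ux /=; rewrite !hval_out // mul0r. Qed.
Program Definition hsec1 : OLambda U := @OSection U (fun x => if `[< oset U x >] then 1 else 0) _ _.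
Next Obligation.
move=> x Ux b bx; apply: (locO_congr (locO1 (frame b) x)).
have : \forall y \near x, oset U y by apply: open_nbhs_nbhs; split=> //; exact: opens_open.
by apply: filterS => y Uy; case: asboolP.
Qed.
Next Obligation. by move=> x Ux /=; case: asboolP. Qed.

Lemma hsecDA : associative hsecD. Proof. by move=> s t u; apply: hsecP => x /=; rewrite addrA. Qed.
Lemma hsecDC : commutative hsecD. Proof. by move=> s t; apply: hsecP => x /=; rewrite addrC. Qed.
Lemma hsecD0 : left_id hsec0 hsecD. Proof. by move=> s; apply: hsecP => x /=; rewrite add0r. Qed.
Lemma hsecDN : left_inverse hsec0 hsecN hsecD. Proof. by move=> s; apply: hsecP => x /=; rewrite addNr. Qed.
HB.instance Definition _ := GRing.isZmodule.Build (OLambda U) hsecDA hsecDC hsecD0 hsecDN.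

Lemma hsecMA : associative hsecM. Proof. by move=> s t u; apply: hsecP => x /=; rewrite mulrA. Qed.
Lemma hsec1M : left_id hsec1 hsecM.
Proof. by move=> s; apply: hsecP => x /=; case: asboolP => Ux; rewrite ?mul1r // hval_out // mulr0. Qed.
Lemma hsecM1 : right_id hsec1 hsecM.
Proof. by move=> s; apply: hsecP => x /=; case: asboolP => Ux; rewrite ?mulr1 // hval_out // mul0r. Qed.
Lemma hsecMDl : left_distributive hsecM +%R.
Proof. by move=> s t u; apply: hsecP => x /=; rewrite mulrDl. Qed.
Lemma hsecMDr : right_distributive hsecM +%R.
Proof. by move=> s t u; apply: hsecP => x /=; rewrite mulrDr. Qed.
HB.instance Definition _ := GRing.Zmodule_isPzRing.Build (OLambda U) hsecMA hsec1M hsecM1 hsecMDl hsecMDr.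

Lemma hsecZA a b s : hsecZ a (hsecZ b s) = hsecZ (a * b) s.
Proof. by apply: hsecP => x /=; rewrite scalerA. Qed.
Lemma hsecZ1 : left_id 1 hsecZ. Proof. by move=> s; apply: hsecP => x /=; rewrite scale1r. Qed.
Lemma hsecZDr : right_distributive hsecZ +%R.
Proof. by move=> k s t; apply: hsecP => x /=; rewrite scalerDr. Qed.
Lemma hsecZDl s : {morph hsecZ^~ s : a b / a + b}.
Proof. by move=> a b; apply: hsecP => x /=; rewrite scalerDl. Qed.
HB.instance Definition _ := GRing.Zmodule_isLmodule.Build C (OLambda U) hsecZA hsecZ1 hsecZDr hsecZDl.
End Ring.

Program Definition restr (U V : opens M) (VU : V `<=` U) (s : OLambda U) : OLambda V :=
  @OSection V (fun x => if `[< oset V x >] then s x else 0) _ _.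
Next Obligation.
move=> U V VU s x Vx b bx; apply: locO_congr (hval_holo s (VU _ Vx) bx) _.
have : \forall y \near x, oset V y by apply: open_nbhs_nbhs; split=> //; exact: opens_open.
by apply: filterS => y Vy; case: asboolP.
Qed.
Next Obligation. by move=> U V VU s x Ux /=; case: asboolP. Qed.

(* Endomorphisms over U of the sheaf of complex vector spaces of holomorphic
   sections of the exterior power of E. *)
Record shend (U : opens M) := ShEnd {
  shapp :> forall V : opens M, V `<=` U -> {linear OLambda V -> OLambda V};
  shapp_restr : forall (V W : opens M) (VU : V `<=` U) (WU : W `<=` U) (WV : W `<=` V) (s : OLambda V),
    restr WV (shapp VU s) = shapp WU (restr WV s) }.

Program Definition shend_restr (U V : opens M) (VU : V `<=` U) (phi : shend U) : shend V :=
  @ShEnd V (fun W WV => phi W (subset_trans WV VU)) _.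
Next Obligation. by move=> *; apply: shapp_restr. Qed.

Definition sec_supp (P : nat -> Prop) U (s : OLambda U) := forall x, ext_supp P (s x).

(* phi is a section over U of G_E: an automorphism of the sheaf of Z/2-graded
   C-algebras that raises the degree by positive even amounts modulo the identity. *)
Record in_G (U : opens M) (phi : shend U) : Prop := InG {
  inG_bij : forall V VU, bijective (phi V VU);
  inG_mon : forall V VU, monoid_morphism (phi V VU);
  inG_even : forall V VU (s : OLambda V),
    sec_supp (fun m => ~~ odd m) s -> sec_supp (fun m => ~~ odd m) (phi V VU s);
  inG_odd : forall V VU (s : OLambda V),
    sec_supp (fun m => odd m) s -> sec_supp (fun m => odd m) (phi V VU s);
  inG_fil : forall V VU j (s : OLambda V), sec_supp (fun m => m = j) s ->
    sec_supp (fun m => exists2 k, (1 <= k)%N & m = (j + k.*2)%N) (phi V VU s - s) }.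

End OneBundle.
End Sections.

Record ocover (R : realType) n (M : cmanifold R n) := OCover {
  oidx : Type;
  oset_of :> oidx -> opens M;
  ocoverP : forall x, exists i, oset (oset_of i) x }.

Section Cech.
Variables (R : realType) (n : nat) (M : cmanifold R n) (r : nat) (E : hvb M r).

Definition cochain0 (U : ocover M) := forall i, shend E (U i).
Definition cochain1 (U : ocover M) := forall i j, shend E (ocap (U i) (U j)).

Definition in_Z1G (U : ocover M) (alpha : cochain1 U) : Prop :=
  (forall i j, in_G (alpha i j)) /\
  (forall i j k (V : opens M) (Vij : V `<=` ocap (U i) (U j)) (Vjk : V `<=` ocap (U j) (U k))
     (Vik : V `<=` ocap (U i) (U k)) (s : OLambda E V),
     alpha i j V Vij (alpha j k V Vjk s) = alpha i k V Vik s).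

(* alpha_ij = beta_i alpha'_ij beta_j^-1, with beta_j moved to the other side. *)
Definition cohom_on (U : ocover M) (alpha alpha' : cochain1 U) : Prop :=
  exists2 beta : cochain0 U, (forall i, in_G (beta i)) &
  forall i j (V : opens M) (Vi : V `<=` U i) (Vj : V `<=` U j)
    (Vij : V `<=` ocap (U i) (U j)) (s : OLambda E V),
    alpha i j V Vij (beta j V Vj s) = beta i V Vi (alpha' i j V Vij s).

Definition refines (W U : ocover M) (rho : oidx W -> oidx U) := forall k, W k `<=` U (rho k).

Definition cochain1_refine (W U : ocover M) rho (hrho : @refines W U rho) (alpha : cochain1 U) : cochain1 W :=
  fun k l => @shend_restr _ _ _ _ E (ocap (U (rho k)) (U (rho l))) (ocap (W k) (W l)) (setISS (hrho k) (hrho l)) (alpha (rho k) (rho l)).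

Record Z1G := MkZ1G {
  zcover : ocover M;
  zval :> cochain1 zcover;
  zvalP : in_Z1G zval }.

(* Cocycles on two covers agree in the direct limit over all open covers. *)
Definition cohom (alpha alpha' : Z1G) : Prop :=
  exists (W : ocover M) rho rho' (hrho : @refines W (zcover alpha) rho) (hrho' : @refines W (zcover alpha') rho'),
  cohom_on (cochain1_refine hrho alpha) (cochain1_refine hrho' alpha').

(* The elements of the cohomology set are the cohomology classes, as sets of
   cocycles. *)
Definition H1G := {c : set Z1G | exists alpha, c = cohom alpha}.
Definition H1class alpha : H1G := exist _ (cohom alpha) (ex_intro _ alpha erefl).
End Cech.

Arguments holo_section {R n M r} E U s.

Section BundleMaps.
Variables (R : realType) (n : nat) (M : cmanifold R n).
Local Notation C := (Cplx R).

Record bmap r q (E : hvb M r) (F : hvb M q) := BMap {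
  bfun :> forall x, {linear E x -> F x};
  bfun_holo : forall (b : fidx (fatlas E)) (c : fidx (fatlas F)) i j, holo_on (fdom b `&` fdom c)
    (fun x => coord (frame c x) i (bfun x (tnth (frame b x) j))) }.

Lemma tnth_basis_exp (K : fieldType) (V : vectType K) m (e : m.-tuple V) v :
  basis_of {:V} e -> v = \sum_j coord e j v *: tnth e j.
Proof.
move=> be; rewrite {1}(coord_basis be (memvf v)); apply: eq_bigr => j _.
by rewrite (tnth_nth 0).
Qed.

Lemma near_open (A : set M) x : open A -> A x -> \forall y \near x, A y.
Proof. by move=> oA Ax; apply: open_nbhs_nbhs. Qed.

Lemma bmap_holo r q (E : hvb M r) (F : hvb M q) (f : bmap E F) (U : set M) s :
  holo_section E U s -> holo_section F U (fun x => ext_map (f x) (s x)).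
Proof.
move=> hs x Ux c cx; have [b bx] := fdom_cover (fatlas E) x.
have nb := near_open (fdom_open b) bx; have nc := near_open (fdom_open c) cx.
apply: locO_map (hs x Ux b bx); last first.
  apply: filterS2 nb nc => y yb yc i.
  exact: (tnth_basis_exp _ (frame_basis yc)).
by move=> i j; apply: filterS2 nb nc => y yb yc; apply: bfun_holo.
Qed.

Section ExtSec.
Variables (r q : nat) (E : hvb M r) (F : hvb M q) (f : bmap E F) (U : opens M).
Program Definition ext_sec (s : OLambda E U) : OLambda F U :=
  @OSection _ _ _ _ F U (fun x => ext_map (f x) (s x)) _ _.
Next Obligation. by move=> s; apply: bmap_holo; apply: hval_holo. Qed.
Next Obligation. by move=> s x Ux /=; rewrite hval_out // linear0. Qed.
Lemma ext_sec_is_linear : linear ext_sec.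
Proof. by move=> k s t; apply: hsecP => x /=; rewrite linearP. Qed.
HB.instance Definition _ := GRing.isLinear.Build C (OLambda E U) (OLambda F U) *:%R ext_sec ext_sec_is_linear.
End ExtSec.
Arguments ext_sec {r q E F} f {U} s.

Lemma ext_sec_restr r q (E : hvb M r) (F : hvb M q) (f : bmap E F) (U V : opens M) (VU : V `<=` U) s :
  restr VU (ext_sec f s) = ext_sec f (restr VU s).
Proof. by apply: hsecP => x /=; case: asboolP; rewrite ?linear0. Qed.

(* A family of subspaces of the fibres of E with a structure of holomorphic
   vector bundle making the inclusion into E holomorphic. *)
Record subbundle r (E : hvb M r) (k : nat) := SubBundle {
  sfib :> forall x, {vspace E x};
  satlas : frames (fun x => subvs_of (sfib x) : vectType C) k;
  sincl_holo : forall (b : fidx satlas) (c : fidx (fatlas E)) i j, holo_on (fdom b `&` fdom c)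
    (fun x => coord (frame c x) i (vsval (tnth (frame b x) j))) }.

Definition sub_hvb r (E : hvb M r) k (F : subbundle E k) : hvb M k := HVB (satlas F).

Definition is_dsum r (E : hvb M r) k k' (F : subbundle E k) (F' : subbundle E k') :=
  forall x, (F x + F' x = fullv)%VS /\ (F x :&: F' x = 0)%VS.

Definition sub_incl r (E : hvb M r) k (F : subbundle E k) : bmap (sub_hvb F) E :=
  @BMap _ _ (sub_hvb F) E (fun x => vsval : {linear subvs_of (F x) -> E x}) (@sincl_holo _ _ _ F).

(* Projection onto F x along F' x. *)
Definition dsum_pr r (E : hvb M r) k k' (F : subbundle E k) (F' : subbundle E k') x :
   {linear E x -> subvs_of (F x)} := (vsproj (F x) \o daddv_pi (F x) (F' x))%FUN.

Lemma holo_at_near (g h : M -> C) x :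
  (\forall y \near x, g y = h y) -> holo_at g x -> holo_at h x.
Proof.
move=> gh hg a ax; apply: near_eq_differentiable (hg a ax).
have cv : cinv a @ cmap a x --> cinv a (cmap a x) := cinv_cts ax.
by apply: (cv (fun y => g y = h y)); rewrite cmapK.
Qed.

Lemma dim_subvs (K : fieldType) (V : vectType K) (U : {vspace V}) :
  \dim {: subvs_of U} = \dim U.
Proof. by rewrite dimvf. Qed.

Lemma dsum_pr_holo r (E : hvb M r) k k' (F : subbundle E k) (F' : subbundle E k') :
  is_dsum F F' ->
  forall (b : fidx (fatlas E)) (c : fidx (fatlas (sub_hvb F))) i j, holo_on (fdom b `&` fdom c)
    (fun x => coord (frame c x) i (dsum_pr F F' x (tnth (frame b x) j))).
Proof.
move=> EFF b c i j x [bx cx]; have [c' c'x] := fdom_cover (satlas F') x.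
have rE : r = (k + k')%N.
  have [sFF iFF] := EFF x.
  rewrite -(size_basis (frame_basis bx)) -(size_basis (frame_basis cx)) -(size_basis (frame_basis c'x)).
  by rewrite !dim_subvs -sFF dimv_disjoint_sum.
subst r.
pose T y (l : 'I_(k + k')) : E y := match fintype.split l with
  | inl p => vsval (tnth (frame c y) p) | inr p => vsval (tnth (frame c' y) p) end.
pose A y : 'M[C]_(k + k') := \matrix_(p, q) coord (frame b y) p (T y q).
pose B y : 'M[C]_(k + k') := \matrix_(p, q) match fintype.split p with
  | inl p => coord (frame c y) p (vsproj (F y) (daddv_pi (F y) (F' y) (tnth (frame b y) q)))
  | inr p => coord (frame c' y) p (vsproj (F' y) (daddv_pi (F' y) (F y) (tnth (frame b y) q)))
  end.
have AB y : fdom b y -> fdom c y -> fdom c' y -> A y *m B y = 1%:M.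
  move=> yb yc yc'; have [sFF iFF] := EFF y; apply/matrixP => p q; rewrite !mxE.
  have -> : (p == q)%:R = coord (frame b y) p (tnth (frame b y) q).
    by rewrite (tnth_nth 0) coord_free ?(basis_free (frame_basis yb)) // eq_sym.
  rewrite -[X in coord _ _ X](@daddv_pi_add _ _ (F y) (F' y)) // ?sFF ?memvf //.
  rewrite -[daddv_pi (F y) _ _](vsprojK (memv_pi _ _ _)).
  rewrite -[daddv_pi (F' y) _ _](vsprojK (memv_pi _ _ _)).
  rewrite (tnth_basis_exp (vsproj (F y) _) (frame_basis yc)).
  rewrite (tnth_basis_exp (vsproj (F' y) _) (frame_basis yc')).
  rewrite !linear_sum linearD !linear_sum big_split_ord /=; congr (_ + _);
    apply: eq_bigr => l _; rewrite !mxE /T.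
    by rewrite (unsplitK (inl l)) !linearZ /= mulrC.
  by rewrite (unsplitK (inr l)) !linearZ /= mulrC.
have nb := near_open (fdom_open b) bx; have nc := near_open (fdom_open c) cx.
have nc' := near_open (fdom_open c') c'x.
have uA y : fdom b y -> fdom c y -> fdom c' y -> A y \in unitmx.
  by move=> yb yc yc'; case: (mulmx1_unit (AB _ yb yc yc')).
apply: (@holo_at_near (fun y => (\det (A y))^-1 * (\adj (A y)) (lshift k' i) j)).
  apply: filterS3 nb nc nc' => y yb yc yc'.
  have -> : coord (frame c y) i (dsum_pr F F' y (tnth (frame b y) j)) = B y (lshift k' i) j.
    by rewrite mxE (unsplitK (inl i)).
  rewrite -[B y](mulKmx (uA _ yb yc yc')) AB // mulmx1.
  by rewrite /invmx (uA _ yb yc yc') [RHS]mxE.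
apply: holo_at_invmx; first exact: uA.
move=> p q; rewrite (_ : (fun y => _) = fun y => coord (frame b y) p (T y q)); last first.
  by apply/funext => y; rewrite mxE.
rewrite /T; case: (fintype.split q) => l.
  exact: (sincl_holo (c := b) (b := c)).
exact: (sincl_holo (c := b) (b := c')).
Qed.

Definition sub_proj r (E : hvb M r) k k' (F : subbundle E k) (F' : subbundle E k')
  (EFF' : is_dsum F F') : bmap E (sub_hvb F) := BMap (dsum_pr_holo EFF').

Program Definition shend_F r (E : hvb M r) k k' (F : subbundle E k) (F' : subbundle E k')
  (EFF' : is_dsum F F') (U : opens M) (phi : shend E U) : shend (sub_hvb F) U :=
  @ShEnd _ _ _ _ (sub_hvb F) U (fun V VU => (ext_sec (sub_proj EFF') \o phi V VU \o ext_sec (sub_incl F))%FUN) _.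
Next Obligation.
move=> r E k k' F F' EFF' U phi V W VU WU WV s /=.
by rewrite ext_sec_restr (shapp_restr _ _ WU) ext_sec_restr.
Qed.

Definition cochain_F r (E : hvb M r) k k' (F : subbundle E k) (F' : subbundle E k')
  (EFF' : is_dsum F F') (U : ocover M) (alpha : cochain1 E U) : cochain1 (sub_hvb F) U :=
  fun i j => shend_F EFF' (alpha i j).
End BundleMaps.

(* Main.v *)
(* Write I for the inclusion of Lambda F, P for Lambda pr_F, so that P I = Id.
   For phi, psi in G_E and a section s of Lambda F, the section
   (Id - I P) psi I s = (Id - I P)(psi I s - I s) is killed by P and has only
   components of degree >= 2. Applying phi changes it by terms of degree >= 4,
   which P maps to 0 because F has rank <= 3. Hence
   P phi psi I = (P phi I)(P psi I), so that alpha |-> alpha_F respects both the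
   cocycle condition and coboundaries. For the same reason P phi I = Id + N with
   N^2 = 0, hence P phi I is bijective. *)

Require Import Defs.
From mathcomp Require Import all_boot all_order all_algebra.
From mathcomp Require Import reals.
From HB Require Import structures.
From mathcomp Require Import boolp classical_sets functions topology zify.

Set Implicit Arguments. Unset Strict Implicit. Unset Printing Implicit Defensive.
Import GRing.Theory.
Local Open Scope ring_scope.
Local Open Scope classical_set_scope.

(** * Degree supports and homogeneous components in the exterior algebra *)

Section ExtSupp.
Variables (K : fieldType) (n : nat).
Implicit Types (a b : extalg K n) (P Q : nat -> Prop).

Lemma ext_suppS P Q a : (forall m, P m -> Q m) -> ext_supp P a -> ext_supp Q a.
Proof. by move=> PQ Pa S /Pa /PQ. Qed.

Lemma ext_supp0 P : ext_supp P (0 : extalg K n).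
Proof. by move=> S; rewrite ffunE eqxx. Qed.

Lemma ext_suppD P a b : ext_supp P a -> ext_supp P b -> ext_supp P (a + b).
Proof.
move=> Pa Pb S; rewrite ffunE; have [aS0|/Pa //] := eqVneq (a S) 0.
by rewrite aS0 add0r => /Pb.
Qed.

Lemma ext_suppZ P k a : ext_supp P a -> ext_supp P (k *: a).
Proof.
move=> Pa S; rewrite ffunE; have [aS0|/Pa //] := eqVneq (a S) 0.
by rewrite aS0 scaler0 eqxx.
Qed.

Lemma ext_suppB P a b : ext_supp P a -> ext_supp P b -> ext_supp P (a - b).
Proof. by move=> Pa Pb; rewrite -scaleN1r; apply: ext_suppD => //; exact: ext_suppZ. Qed.

Lemma ext_supp_sum P I (r : seq I) (Q : pred I) (F : I -> extalg K n) :
  (forall i, Q i -> ext_supp P (F i)) -> ext_supp P (\sum_(i <- r | Q i) F i).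
Proof.
by move=> PF; apply: big_ind PF; [exact: ext_supp0|exact: ext_suppD].
Qed.

Lemma ext_supp1 : ext_supp (fun m => m = 0%N) (1 : extalg K n).
Proof.
move=> S; rewrite ffunE; have [->|] := eqVneq S finset.set0; last by rewrite eqxx.
by rewrite cards0.
Qed.

Lemma ext_suppM p q a b : ext_supp (fun m => m = p) a -> ext_supp (fun m => m = q) b ->
  ext_supp (fun m => m = (p + q)%N) (a * b).
Proof.
move=> pa qb U; rewrite ffunE => /eqP abU; apply: contrapT => nU.
apply: abU; apply: big1 => S SU.
have [->|/pa pS] := eqVneq (a S) 0; first by rewrite mul0r mulr0.
have [->|/qb qS] := eqVneq (b (finset.setD U S)) 0; first by rewrite !mulr0.
by case: nU; rewrite -pS -qS -(finset.cardsID S U) (finset.setIidPr SU).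
Qed.

Definition ext_comp (j : nat) a : extalg K n := [ffun S : {set 'I_n} => if #|S| == j then a S else 0].

Lemma ext_comp_is_linear j : linear (ext_comp j).
Proof.
move=> k a b; apply/ffunP => S; rewrite !ffunE; case: ifP => // _.
by rewrite scaler0 addr0.
Qed.
HB.instance Definition _ j := GRing.isLinear.Build K (extalg K n) (extalg K n) *:%R
  (ext_comp j) (ext_comp_is_linear j).

Lemma ext_comp_supp j a : ext_supp (fun m => m = j) (ext_comp j a).
Proof. by move=> S; rewrite ffunE; case: ifP => [/eqP|]; rewrite ?eqxx. Qed.

Lemma ext_comp_hom i j a : ext_supp (fun m => m = i) a ->
  ext_comp j a = if i == j then a else 0.
Proof.
move=> ia; apply/ffunP => S; rewrite ffunE; have [aS0|/ia ->] := eqVneq (a S) 0.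
  by case: ifP; case: ifP; rewrite ?ffunE ?aS0.
by case: ifP; rewrite // ffunE.
Qed.

Lemma ext_comp_eq0 P j a : ext_supp P a -> ~ P j -> ext_comp j a = 0.
Proof.
move=> Pa nPj; apply/ffunP => S; rewrite !ffunE; case: eqVneq => // Sj.
by have [//|/Pa] := eqVneq (a S) 0; rewrite Sj.
Qed.

Lemma ext_suppP P a : (forall j, ~ P j -> ext_comp j a = 0) -> ext_supp P a.
Proof.
move=> Pa S aS; apply: contrapT => /Pa /ffunP /(_ S); rewrite !ffunE eqxx => /eqP.
by rewrite (negPf aS).
Qed.

Lemma ext_comp_sum m a : (n < m)%N -> a = \sum_(j < m) ext_comp j a.
Proof.
move=> nm; apply/ffunP => S; rewrite sum_ffunE.
have Sm : (#|S| < m)%N by apply: leq_ltn_trans (max_card (mem S)) _; rewrite card_ord.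
rewrite (bigD1 (Ordinal Sm)) //= ffunE eqxx big1 ?addr0 // => j nj.
by rewrite ffunE; case: eqVneq => // Sj; case/eqP: nj; apply: val_inj.
Qed.

(** An index set has at most n elements. The bound on the rank of F enters through this lemma, with
    m = 3. *)
Lemma ext_supp_gt a m : (n <= m)%N -> ext_supp (fun p => (m < p)%N) a -> a = 0.
Proof.
move=> nm ma; apply/ffunP => S; rewrite ffunE; have [//|/ma] := eqVneq (a S) 0.
by move=> mS; have := leq_trans (leq_ltn_trans nm mS) (max_card (mem S)); rewrite card_ord ltnn.
Qed.

Lemma ext_supp_wedge q (x : 'I_q -> extalg K n) (S : {set 'I_q}) :
  (forall i, ext_supp (fun m => m = 1%N) (x i)) -> ext_supp (fun m => m = #|S|) (wedge x S).
Proof.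
move=> hx; rewrite /wedge -sum1_card.
elim/big_ind2: _ => //; [exact: ext_supp1|].
by move=> p a p' b; exact: ext_suppM.
Qed.
End ExtSupp.

(** * Supports and functoriality for exterior powers of maps *)

Lemma ext_supp_gen (K : fieldType) n (S : {set 'I_n}) :
  ext_supp (fun m => m = #|S|) (ext_delta K S).
Proof. by move=> T; rewrite ffunE; case: (eqVneq T S) => [->//|]; rewrite eqxx. Qed.

Lemma ext_supp_iota (K : fieldType) (V : vectType K) (v : V) :
  ext_supp (fun m => m = 1%N) (ext_iota v).
Proof.
apply: ext_supp_sum => i _; apply: ext_suppZ.
by rewrite -(finset.cards1 i); exact: ext_supp_gen.
Qed.

(** Each basis element e_S is sent to a product of #|S| elements of degree one. *)
Lemma ext_supp_map (K : fieldType) (V W : vectType K) (f : V -> W) P (a : Lambda V) :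
  ext_supp P a -> ext_supp P (ext_map f a).
Proof.
move=> Pa; apply: ext_supp_sum => S _.
have [->|/Pa PS] := eqVneq (a S) 0; first by rewrite scale0r; exact: ext_supp0.
apply: ext_suppZ; apply: (ext_suppS _ (ext_supp_wedge _)); first by move=> _ ->.
by move=> i; exact: ext_supp_iota.
Qed.

(** Induction on #|S|, splitting off one generator: [wedge_mul] and [ext_deltaM] produce the same
    sign, which cancels. This makes multiplicative arguments available on the coordinate basis. *)
Lemma wedge_gen (K : fieldType) n (S : {set 'I_n}) : wedge (@ext_gen K n) S = ext_delta K S.
Proof.
move: {2}#|S| (erefl #|S|) => m; elim: m S => [|m IH] S cS.
  by rewrite (finset.cards0_eq cS) /wedge finset.big_set0.
have /card_gt0P[i iS] : (0 < #|S|)%N by rewrite cS.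
have := @wedge_mul _ _ (@ext_gen K n) (@ext_genM K n) (@ext_genC K n)
  (finset.set1 i) (finset.setD S (finset.set1 i)).
have := ext_deltaM K (finset.set1 i) (finset.setD S (finset.set1 i)).
rewrite disjoints1 !finset.inE eqxx /= finset.setD1K //.
rewrite {1}/wedge finset.big_set1 IH; last first.
  by have := finset.cardsD1 i S; rewrite iS; lia.
rewrite {1}/ext_gen => ->; rewrite -signr_odd -[X in _ = X * _]signr_odd.
case: odd; rewrite ?expr1 ?expr0 ?scaleN1r ?mulN1r ?scale1r ?mul1r => //.
by move/oppr_inj.
Qed.

(** By multiplicativity and [wedge_gen] it suffices to compare both sides on generators, where
    [ext_map_iota] applies. *)
Lemma ext_map_cancel (K : numFieldType) (V W : vectType K) (f : {linear V -> W})
  (g : {linear W -> V}) : cancel f g -> cancel (ext_map f) (ext_map g).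
Proof.
move=> fK a; rewrite [a in RHS]ext_sum_delta [ext_map f a]/ext_map linear_sum; apply: eq_bigr => S _.
rewrite linearZ /=; congr (_ *: _); rewrite ext_map_prod -wedge_gen; apply: eq_bigr => i _.
rewrite ext_map_iota fK /ext_iota (bigD1 i) //= coord_free ?(basis_free (vbasisP _)) //.
rewrite eqxx scale1r big1 ?addr0 // => j ji.
by rewrite coord_free ?(basis_free (vbasisP _)) // eq_sym (negPf ji) scale0r.
Qed.

(** * Holomorphic homogeneous components and degree-raising maps *)

Section Raises.
Variables (R : realType) (n : nat) (M : cmanifold R n) (r : nat) (E : hvb M r) (U : opens M).
Implicit Types (s : OLambda E U) (P Q : nat -> Prop).

Lemma dim_fibre x : \dim {:E x} = r.
Proof. by have [b bx] := fdom_cover (fatlas E) x; rewrite (size_basis (frame_basis bx)). Qed.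

Lemma hsec_sum I (l : seq I) (Q : pred I) (t : I -> OLambda E U) x :
  (\sum_(i <- l | Q i) t i : OLambda E U) x = \sum_(i <- l | Q i) t i x.
Proof. exact: (big_morph (fun s : OLambda E U => s x)). Qed.

Program Definition hcomp (j : nat) s : OLambda E U :=
  @OSection _ _ _ _ E U (fun x => ext_comp j (s x)) _ _.
Next Obligation.
move=> j s x Ux b bx; have [c [hc hs]] := hval_holo s Ux bx.
(* In a local frame e_S is homogeneous of degree #|S|, so the component keeps exactly the
   coefficients with #|S| = j. *)
exists (fun (S : {set 'I_r}) y => if #|S| == j then c S y else 0); split.
  by apply: filterS hc => y h S /=; case: (#|S| == j) => //; exact: holo_at_cst.
apply: filterS hs => y ->; rewrite linear_sum; apply: eq_bigr => S _.
rewrite linearZ /= (ext_comp_hom _ (ext_supp_wedge _)); last first.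
  by move=> i; exact: ext_supp_iota.
by case: ifP; rewrite ?scaler0 ?scale0r.
Qed.
Next Obligation. by move=> j s x Ux /=; rewrite hval_out // linear0. Qed.

Lemma hcomp_sum s : s = \sum_(j < r.+1) hcomp j s.
Proof.
by apply: hsecP => x; rewrite hsec_sum; apply: ext_comp_sum; rewrite dim_fibre.
Qed.

Lemma hcomp_supp j s : sec_supp (fun m => m = j) (hcomp j s).
Proof. by move=> x; exact: ext_comp_supp. Qed.

Lemma hcomp_eq0 P j s : sec_supp P s -> ~ P j -> hcomp j s = 0.
Proof. by move=> Ps nPj; apply: hsecP => x; exact: ext_comp_eq0 (Ps x) nPj. Qed.

(** The filtration condition of [in_G] for a single map, isolated so that it can be proved for
    inverses and compressions before these are known to lie in the group. *)
Definition raises (phi : OLambda E U -> OLambda E U) := forall j s,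
  sec_supp (fun m => m = j) s ->
  sec_supp (fun m => exists2 i, (1 <= i)%N & m = (j + i.*2)%N) (phi s - s).

Variable phi : {linear OLambda E U -> OLambda E U}.
Hypothesis phiR : raises phi.

Lemma raises_expand s x :
  (phi s - s) x = \sum_(j < r.+1) (phi (hcomp j s) - hcomp j s) x.
Proof. by rewrite [s in LHS]hcomp_sum linear_sum -sumrB hsec_sum. Qed.

(** [raises] speaks of homogeneous sections only; linearity and the decomposition into components
    extend it to any set P of degrees. *)
Lemma raises_supp P Q s : (forall j i, P j -> (1 <= i)%N -> Q (j + i.*2)%N) ->
  sec_supp P s -> sec_supp Q (phi s - s).
Proof.
move=> PQ Ps x; rewrite raises_expand; apply: ext_supp_sum => j _.
have [Pj|nPj] := pselect (P j).
  by move=> S /(phiR (@hcomp_supp j s)) [i i1 ->]; exact: PQ.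
by rewrite (hcomp_eq0 Ps nPj) linear0 subr0; exact: ext_supp0.
Qed.

Lemma raises_stable P s : (forall j i, P j -> P (j + i.*2)%N) ->
  sec_supp P s -> sec_supp P (phi s).
Proof.
move=> Pc Ps; rewrite -[phi s](subrK s) => x; apply: ext_suppD (Ps x).
by apply: raises_supp Ps x => j i Pj _; exact: Pc.
Qed.

(** The degree m part of s is that of phi s minus contributions of components of s of degree below
    m. Strong induction on m therefore kills every component of degree outside P. *)
Lemma raises_reflect P s : (forall j i, P j -> P (j + i.*2)%N) ->
  sec_supp P (phi s) -> sec_supp P s.
Proof.
move=> Pc Pps x; apply: ext_suppP => m nPm; rewrite -[LHS]/(hcomp m s x).
suff -> : hcomp m s = 0 by [].
elim/ltn_ind: m nPm {x} => m IH nPm; apply: hsecP => x /=.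
rewrite -[s x](subKr (phi s x)) linearB /= (ext_comp_eq0 (Pps x) nPm) sub0r.
rewrite -[_ - _]/((phi s - s) x) raises_expand linear_sum big1 ?oppr0 // => j _.
(* If m = j + 2i with i >= 1, then j is outside P, as P is closed under even steps, and the
   induction hypothesis gives a zero j-th component. Otherwise that component contributes nothing in
   degree m. *)
have [[i i1 mE]|nm] := pselect (exists2 i, (1 <= i)%N & m = (j + i.*2)%N).
  have jm : (j < m)%N by rewrite mE -[X in (X < _)%N]addn0 ltn_add2l double_gt0.
  by rewrite IH ?(linear0 phi) ?subrr ?linear0 // => /Pc Pj; apply: nPm; rewrite mE.
exact: ext_comp_eq0 (fun S => phiR (@hcomp_supp j s) (x := x) (S := S)) nm.
Qed.
End Raises.

(** * Group laws and restriction in G_E *)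

Section GroupLaws.
Variables (R : realType) (n : nat) (M : cmanifold R n) (r : nat) (E : hvb M r).
Local Notation C := (Cplx R).

Lemma shapp_irr (U V : opens M) (phi : shend E U) (h h' : V `<=` U) : phi V h = phi V h'.
Proof. by rewrite (Prop_irrelevance h h'). Qed.

Lemma in_G_raises (U : opens M) (phi : shend E U) :
  in_G phi -> forall (V : opens M) (VU : V `<=` U), raises (phi V VU).
Proof. by move=> Gphi V VU; exact: inG_fil. Qed.
Arguments in_G_raises {U phi} Gphi {V} VU.

(** Even steps preserve parity, so both grading conditions follow from the filtration condition. *)
Lemma in_G_of_raises (U : opens M) (phi : shend E U) :
  (forall V VU, bijective (phi V VU)) -> (forall V VU, monoid_morphism (phi V VU)) ->
  (forall V VU, raises (phi V VU)) -> in_G phi.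
Proof.
move=> bphi mphi Rphi; split=> // V VU s Ps; apply: (raises_stable (Rphi V VU) _ Ps) => j i;
  by rewrite oddD odd_double addbF.
Qed.

Definition shend_id (U : opens M) : shend E U :=
  @ShEnd _ _ _ _ _ U (fun V VU => idfun) (fun V W VU WU WV s => erefl).

Lemma in_G_id (U : opens M) : in_G (shend_id U).
Proof.
apply: in_G_of_raises => V VU; first by exists id.
  by split.
by move=> j s _ x; rewrite subrr; exact: ext_supp0.
Qed.

Program Definition shend_comp (U : opens M) (phi psi : shend E U) : shend E U :=
  @ShEnd _ _ _ _ _ U (fun V VU => (phi V VU \o psi V VU)%FUN) _.
Next Obligation.
by move=> U phi psi V W VU WU WV s; rewrite /= (shapp_restr phi VU WU) (shapp_restr psi VU WU).
Qed.

Lemma in_G_comp (U : opens M) (phi psi : shend E U) :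
  in_G phi -> in_G psi -> in_G (shend_comp phi psi).
Proof.
move=> Gphi Gpsi; apply: in_G_of_raises => V VU.
- exact: bij_comp (inG_bij Gphi VU) (inG_bij Gpsi VU).
- have [phi1 phiM] := inG_mon Gphi VU; have [psi1 psiM] := inG_mon Gpsi VU.
  by split=> [|s t] /=; rewrite ?psi1 ?psiM ?phi1 ?phiM.
move=> j s js x /=.
have psis := in_G_raises Gpsi VU _ _ js.
(* Split phi psi s - s as (phi psi s - psi s) + (psi s - s). As psi s need not be homogeneous, the
   first summand is treated with all degrees j + 2i, i >= 0. *)
rewrite -(subrK (psi V VU s) (phi V VU _)) -addrA; apply: ext_suppD (psis x).
apply: (raises_supp (in_G_raises Gphi VU) (P := fun m => exists i, m = (j + i.*2)%N)) => //.
  by move=> _ i [k ->] i1; exists (k + i)%N; [lia|rewrite doubleD addnA].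
rewrite -[psi V VU s](subrK s) => y; apply: ext_suppD.
  by move=> S /(psis y) [i _ ->]; exists i.
by move=> S /(js y) ->; exists 0%N; rewrite addn0.
Qed.

Lemma linear_bij_inv (A B : lmodType C) (f : {linear A -> B}) :
  bijective f -> exists g : {linear B -> A}, cancel f g /\ cancel g f.
Proof.
case=> g fK gK; have lg : linear g := can2_linear fK gK.
by exists (HB.pack_for {linear B -> A} g (GRing.isLinear.Build _ _ _ _ g lg)).
Qed.

(** Linearity, multiplicativity and compatibility with restriction pass to the inverses because phi
    is injective. For the filtration, [raises_reflect] reduces to phi (psi s - s) = s - phi s. *)
Lemma in_G_inv (U : opens M) (phi : shend E U) : in_G phi -> exists2 psi : shend E U,
  in_G psi & forall V VU, cancel (phi V VU) (psi V VU) /\ cancel (psi V VU) (phi V VU).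
Proof.
move=> Gphi; pose g V VU := cid (linear_bij_inv (inG_bij Gphi (V:=V) VU)).
have gK V VU : cancel (phi V VU) (sval (g V VU)) := (svalP (g V VU)).1.
have Kg V VU : cancel (sval (g V VU)) (phi V VU) := (svalP (g V VU)).2.
have rg (V W : opens M) (VU : V `<=` U) (WU : W `<=` U) (WV : W `<=` V) (s : OLambda E V) :
  restr WV (sval (g V VU) s) = sval (g W WU) (restr WV s).
  by apply: (can_inj (gK W WU)); rewrite Kg -(shapp_restr _ VU) Kg.
exists (ShEnd rg); last by move=> V VU; split; [exact: gK|exact: Kg].
apply: in_G_of_raises => V VU /=.
- exact: Bijective (Kg V VU) (gK V VU).
- have [phi1 phiM] := inG_mon Gphi VU.
  by split=> [|s t]; apply: (can_inj (gK V VU)); rewrite ?phiM !Kg.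
move=> j s js; apply: (raises_reflect (in_G_raises Gphi VU)).
  by move=> _ i [k k1 ->]; exists (k + i)%N; [lia|rewrite doubleD addnA].
rewrite linearB /= Kg => x; rewrite -[s - _]opprB -scaleN1r.
by apply: ext_suppZ; exact: (in_G_raises Gphi VU _ _ js x).
Qed.

Lemma in_G_restr (U V : opens M) (VU : V `<=` U) (phi : shend E U) :
  in_G phi -> in_G (shend_restr VU phi).
Proof.
move=> Gphi; apply: in_G_of_raises => W WV /=.
- exact: inG_bij.
- exact: inG_mon.
exact: in_G_raises.
Qed.
End GroupLaws.

(** * Cohomologous cocycles form an equivalence relation *)

Section CohomEquiv.
Variables (R : realType) (n : nat) (M : cmanifold R n) (r : nat) (E : hvb M r).
Implicit Types alpha : Z1G E.

Lemma cohom_refl alpha : cohom alpha alpha.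
Proof.
have id_ref : refines (W := zcover alpha) (U := zcover alpha) id by move=> k; exact: subset_refl.
exists (zcover alpha), id, id, id_ref, id_ref.
by exists (fun i => shend_id E _) => // i; exact: in_G_id.
Qed.

Lemma cohom_sym alpha alpha' : cohom alpha alpha' -> cohom alpha' alpha.
Proof.
move=> [W [rho [rho' [hrho [hrho' [beta Gbeta betaE]]]]]].
exists W, rho', rho, hrho', hrho.
have inv i := cid2 (in_G_inv (Gbeta i)).
pose gamma i := s2val (inv i).
have gammaK i V VU : cancel (beta i V VU) (gamma i V VU) := (s2valP' (inv i) V VU).1.
have Kgamma i V VU : cancel (gamma i V VU) (beta i V VU) := (s2valP' (inv i) V VU).2.
exists gamma => [i|i j V Vi Vj Vij s]; first exact: s2valP (inv i).
apply: (can_inj (gammaK i V Vi)); rewrite Kgamma -betaE.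
by rewrite Kgamma.
Qed.

(** Unfolds the refinements and frees the inclusion proofs, so that the coboundary relation can
    serve as a rewrite rule. *)
Lemma cohom_on_refineE (U U' W : ocover M) (alpha : cochain1 E U) (alpha' : cochain1 E U')
    rho rho' (hrho : @refines _ _ _ W U rho) (hrho' : @refines _ _ _ W U' rho')
    (beta : cochain0 E W) :
  (forall i j (V : opens M) (Vi : V `<=` W i) (Vj : V `<=` W j)
    (Vij : V `<=` ocap (W i) (W j)) (s : OLambda E V),
    cochain1_refine hrho alpha i j V Vij (beta j V Vj s) =
    beta i V Vi (cochain1_refine hrho' alpha' i j V Vij s)) ->
  forall i j (V : opens M) (Vi : V `<=` W i) (Vj : V `<=` W j)
    (VA : V `<=` ocap (U (rho i)) (U (rho j))) (VB : V `<=` ocap (U' (rho' i)) (U' (rho' j)))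
    (s : OLambda E V),
  alpha (rho i) (rho j) V VA (beta j V Vj s) =
  beta i V Vi (alpha' (rho' i) (rho' j) V VB s).
Proof.
move=> betaE i j V Vi Vj VA VB s.
have Vij : V `<=` ocap (W i) (W j) by move=> x Vx; split; [exact: Vi|exact: Vj].
by have := betaE i j V Vi Vj Vij s; rewrite /= (shapp_irr _ _ VA) (shapp_irr _ _ VB).
Qed.

Lemma cohom_trans alpha alpha' alpha'' :
  cohom alpha alpha' -> cohom alpha' alpha'' -> cohom alpha alpha''.
Proof.
move=> [W [rho [rho' [hrho [hrho' [beta Gbeta betaE]]]]]].
move=> [T [sigma [tau [hsigma [htau [gamma Ggamma gammaE]]]]]].
(* The intersections of W_i and T_j, indexed by pairs, form a common refinement of the two
   covers. *)
have WTP x : exists p : oidx W * oidx T, oset (ocap (W p.1) (T p.2)) x.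
  have [i Wi] := ocoverP W x; have [j Tj] := ocoverP T x.
  by exists (i, j).
pose WT := @OCover R n M _ (fun p => ocap (W p.1) (T p.2)) WTP.
have hW : refines (W := WT) (U := zcover alpha) (fun p => rho p.1).
  by move=> p x [/hrho].
have hT : refines (W := WT) (U := zcover alpha'') (fun p => tau p.2).
  by move=> p x [_ /htau].
exists WT, (fun p => rho p.1), (fun p => tau p.2), hW, hT.
have W1 (p : oidx WT) : WT p `<=` W p.1 by move=> x [].
have T2 (p : oidx WT) : WT p `<=` T p.2 by move=> x [].
have mid (p : oidx WT) : WT p `<=` ocap (zcover alpha' (rho' p.1)) (zcover alpha' (sigma p.2)).
  by move=> x [/hrho' ? /hsigma].
(* beta alpha'_{rho' sigma} gamma: the middle factor compares the two refinement
   maps rho' and sigma into the cover of alpha'. *)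
pose delta (p : oidx WT) := shend_comp (shend_restr (W1 p) (beta p.1))
  (shend_comp (shend_restr (mid p) (@zval _ _ _ _ _ alpha' (rho' p.1) (sigma p.2)))
     (shend_restr (T2 p) (gamma p.2))).
have [Galpha' alpha'E] := zvalP alpha'.
exists delta => [p|p q V Vp Vq Vpq s] /=.
  by do 2?[apply: in_G_comp]; apply: in_G_restr.
have Vp1 := subset_trans Vp (W1 p); have Vq1 := subset_trans Vq (W1 q).
have Vp2 := subset_trans Vp (T2 p); have Vq2 := subset_trans Vq (T2 q).
have VA : V `<=` ocap (zcover alpha (rho p.1)) (zcover alpha (rho q.1)).
  by move=> x Vx; split; [exact/hrho/Vp1|exact/hrho/Vq1].
have VB : V `<=` ocap (zcover alpha' (rho' p.1)) (zcover alpha' (rho' q.1)).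
  by move=> x Vx; split; [exact/hrho'/Vp1|exact/hrho'/Vq1].
have VC : V `<=` ocap (zcover alpha' (sigma p.2)) (zcover alpha' (sigma q.2)).
  by move=> x Vx; split; [exact/hsigma/Vp2|exact/hsigma/Vq2].
have VD : V `<=` ocap (zcover alpha'' (tau p.2)) (zcover alpha'' (tau q.2)).
  by move=> x Vx; split; [exact/htau/Vp2|exact/htau/Vq2].
have Vm : V `<=` ocap (zcover alpha' (rho' p.1)) (zcover alpha' (sigma q.2)).
  by move=> x Vx; split; [exact/hrho'/Vp1|exact/hsigma/Vq2].
have {}betaE := cohom_on_refineE betaE Vp1 Vq1 VA VB.
have {}gammaE := cohom_on_refineE gammaE Vp2 Vq2 VC VD.
(* Both sides reduce to beta_p alpha'_{rho' p, sigma q} gamma_q: the left by [betaE] and the cocycle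
   rule through rho' q, the right by [gammaE] and the cocycle rule through sigma p. *)
rewrite (shapp_irr _ _ VA) (shapp_irr (beta q.1) _ Vq1) betaE (shapp_irr (beta p.1) _ Vp1).
rewrite (alpha'E _ _ _ _ _ _ Vm) (shapp_irr (gamma q.2) _ Vq2) (shapp_irr (gamma p.2) _ Vp2).
by rewrite (shapp_irr _ _ VD) -gammaE (alpha'E _ _ _ _ _ _ Vm).
Qed.

Lemma H1class_eq alpha alpha' : cohom alpha alpha' -> H1class alpha = H1class alpha'.
Proof.
move=> aa'; apply: eq_exist; apply/predeqP => gamma; split => [|/(cohom_trans aa')//].
exact/cohom_trans/cohom_sym.
Qed.
End CohomEquiv.

(** * The compression P phi I to the exterior algebra of F *)

Lemma ext_secB (R : realType) (n : nat) (M : cmanifold R n) q q' (A : hvb M q) (B : hvb M q')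
    (f : bmap A B) (U : opens M) (s t : OLambda A U) :
  ext_sec f (s - t) = ext_sec f s - ext_sec f t.
Proof. exact: linearB. Qed.

Section Compress.
Variables (R : realType) (n : nat) (M : cmanifold R n) (r k k' : nat) (E : hvb M r).
Variables (F : subbundle E k) (F' : subbundle E k') (EFF' : is_dsum F F').

Section OnOpen.
Variable V : opens M.
Local Notation incl := (@ext_sec _ _ _ _ _ _ _ (sub_incl F) V).
Local Notation proj := (@ext_sec _ _ _ _ _ _ _ (sub_proj EFF') V).

Lemma proj_incl : cancel incl proj.
Proof.
move=> s; apply: hsecP => x /=; apply: ext_map_cancel => v /=.
by have [_ iFF] := EFF' x; rewrite daddv_pi_id ?subvsP // vsvalK.
Qed.

Lemma ext_sec_monoid_morphism q q' (A : hvb M q) (B : hvb M q') (f : bmap A B) :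
  monoid_morphism (ext_sec f (U := V)).
Proof.
split=> [|s t]; apply: hsecP => x /=; last exact: ext_mapM.
by case: asboolP => _; rewrite ?ext_map1 ?linear0.
Qed.

Lemma ext_sec_supp q q' (A : hvb M q) (B : hvb M q') (f : bmap A B) P (s : OLambda A V) :
  sec_supp P s -> sec_supp P (ext_sec f s).
Proof. by move=> Ps x; exact: ext_supp_map (Ps x). Qed.

Lemma sec_supp_gt q (A : hvb M q) m (s : OLambda A V) :
  (q <= m)%N -> sec_supp (fun p => (m < p)%N) s -> s = 0.
Proof.
by move=> qm ms; apply: hsecP => x; apply: ext_supp_gt (ms x); rewrite dim_fibre.
Qed.

(** Even from degree 0, the smallest degree reached is 0 + 2. *)
Lemma raises_gt1 q (A : hvb M q) (phi : {linear OLambda A V -> OLambda A V}) s :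
  raises phi -> sec_supp (fun m => (1 < m)%N) (phi s - s).
Proof. by move=> Rphi; apply: (raises_supp Rphi (P := xpredT)) => // j i _; lia. Qed.

Hypothesis k_le3 : (k <= 3)%N.

(** The difference phi s - s starts in degree 4, above the rank of F. *)
Lemma proj_raises (phi : {linear OLambda E V -> OLambda E V}) s :
  raises phi -> sec_supp (fun m => (1 < m)%N) s -> proj (phi s) = proj s.
Proof.
move=> Rphi s2; apply/eqP; rewrite -subr_eq0 -ext_secB; apply/eqP.
apply: (sec_supp_gt k_le3); apply: ext_sec_supp.
by apply: raises_supp s2 => // j i; lia.
Qed.

Lemma compress_comp (phi psi : {linear OLambda E V -> OLambda E V}) s :
  raises phi -> raises psi ->
  proj (phi (incl (proj (psi (incl s))))) = proj (phi (psi (incl s))).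
Proof.
move=> Rphi Rpsi; set t := psi _; apply/eqP; rewrite eq_sym -subr_eq0 -ext_secB -linearB.
(* Id - I P vanishes on the image of I, so t may be replaced by t - I s, which lives in degrees >=
   2. *)
have -> : t - incl (proj t) = (t - incl s) - incl (proj (t - incl s)).
  by rewrite !ext_secB proj_incl opprB addrA subrK.
have t2 := raises_gt1 (s := incl s) Rpsi.
set u := _ - incl s in t2 *; have u2 : sec_supp (fun m => (1 < m)%N) (u - incl (proj u)).
  by move=> x; apply: ext_suppB (@t2 x) _; do 2!apply: ext_supp_map; exact: t2.
(* [proj_raises] removes phi, and P (u - I P u) = 0 because P I = Id. *)
by rewrite (proj_raises Rphi u2) ext_secB proj_incl subrr.
Qed.

(** Writing s as P I s turns the difference into P (phi I s - I s), and both P and I preserve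
    degrees. *)
Lemma compress_raises (phi : {linear OLambda E V -> OLambda E V}) :
  raises phi -> raises (proj \o phi \o incl).
Proof.
move=> Rphi j s js; rewrite -[X in _ - X]proj_incl -ext_secB.
by apply: ext_sec_supp; apply: Rphi; apply: ext_sec_supp.
Qed.
End OnOpen.

Lemma in_G_F (U : opens M) (phi : shend E U) (k_le3 : (k <= 3)%N) :
  in_G phi -> in_G (shend_F EFF' phi).
Proof.
move=> Gphi; apply: in_G_of_raises => V VU.
- (* f = Id + N with N^2 = 0, so its inverse is Id - N = 2 Id - f. *)
  pose f := shapp (shend_F EFF' phi) VU; have Rf : raises f by apply/compress_raises/in_G_raises.
  have ff s : f (f s) = f s + (f s - s).
    (* The difference of the two sides is f - Id applied to f s - s, hence of degree > 3 in an
       exterior algebra of rank at most 3. *)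
    apply/eqP; rewrite -subr_eq0 opprD addrA -linearB; apply/eqP.
    apply: (sec_supp_gt k_le3); apply: (raises_supp Rf _ (raises_gt1 (s := s) Rf)).
    by move=> j i; lia.
  have fg s : f s + f s - f (f s) = s by rewrite ff addrKA opprB addrC subrK.
  exists (fun s => s + s - f s) => s; last by rewrite linearB linearD fg.
  exact: fg.
- have [phi1 phiM] := inG_mon Gphi VU.
  have [i1 iM] := ext_sec_monoid_morphism V (sub_incl F).
  have [p1 pM] := ext_sec_monoid_morphism V (sub_proj EFF').
  by split=> [|s t] /=; rewrite ?i1 ?phi1 ?p1 ?iM ?phiM ?pM.
exact/compress_raises/in_G_raises.
Qed.

Lemma in_Z1G_F (U : ocover M) (alpha : cochain1 E U) (k_le3 : (k <= 3)%N) :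
  in_Z1G alpha -> in_Z1G (cochain_F EFF' alpha).
Proof.
move=> [Ga aE]; split=> [i j|i j l V Vij Vjl Vil s]; first exact: in_G_F.
by rewrite /= compress_comp ?(aE _ _ _ _ _ _ Vil) //; exact: in_G_raises.
Qed.

(** The same refinement works, with beta compressed: [compress_comp] turns both sides of the new
    relation into compressions of the sides of the old one. *)
Lemma cohom_F (alpha alpha' : Z1G E) (Za : in_Z1G (cochain_F EFF' alpha))
    (Za' : in_Z1G (cochain_F EFF' alpha')) (k_le3 : (k <= 3)%N) :
  cohom alpha alpha' -> cohom (MkZ1G Za) (MkZ1G Za').
Proof.
move=> [W [rho [rho' [hrho [hrho' [beta Gbeta betaE]]]]]].
exists W, rho, rho', hrho, hrho', (fun i => shend_F EFF' (beta i)) => [i|]; first exact: in_G_F.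
move=> i j V Vi Vj Vij s /=.
have [Ga _] := zvalP alpha; have [Ga' _] := zvalP alpha'.
rewrite !compress_comp //; [|exact: in_G_raises..].
by have := betaE i j V Vi Vj Vij; rewrite /= => ->.
Qed.
End Compress.

(** * Passage to cohomology classes *)

Theorem lemma3 (R : realType) (n : nat) (M : cmanifold R n) (r k k' : nat) (E : hvb M r)
   (F : subbundle E k) (F' : subbundle E k') (k_le3 : (k <= 3)%N) (EFF' : is_dsum F F') :
   (forall (U : ocover M) (alpha : cochain1 E U), in_Z1G alpha -> in_Z1G (cochain_F EFF' alpha)) /\
   (exists h : H1G E -> H1G (sub_hvb F),
      forall (U : ocover M) (alpha : cochain1 E U) (Za : in_Z1G alpha) (ZaF : in_Z1G (cochain_F EFF' alpha)),
      h (H1class (MkZ1G Za)) = H1class (MkZ1G ZaF)).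
Proof.
split=> [U alpha|]; first exact: in_Z1G_F.
(* The map is defined through a chosen representative of each class; independence of the choice
   comes from [cohom_F]. *)
pose rep (c : H1G E) := cid (svalP c).
exists (fun c => H1class (MkZ1G (in_Z1G_F EFF' k_le3 (zvalP (sval (rep c)))))) => U alpha Za ZaF.
apply: H1class_eq; apply: (cohom_F (alpha' := MkZ1G Za)) => //; apply: cohom_sym.
(* A class is the set of cocycles cohomologous to a representative, so equality of the two sets
   reduces the claim to reflexivity. *)
suff -> : cohom (MkZ1G Za) = cohom (sval (rep (H1class (MkZ1G Za)))) by exact: cohom_refl.
exact: (svalP (rep (H1class (MkZ1G Za)))).
Qed.
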